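(* Fix a computable enumeration without repetition $((e_i,n_i))_{i\in\mathbb{N}}$ of $\{(e,n) : e,n\in\mathbb{N}\text{ and }\{e\}(n)\text{ converges}\}$. Let $c\in\mathrm{CompStr}$ be a code such that: - $\mathcal{L}_c$ consists of, for each $i\in\mathbb{N}$, a sort $X_i$ and unary relation symbols $U_i$ and $V_i$ of sort $X_i$; - the underlying set of $\mathcal{M}_c$ is $\mathbb{N}\cup(\{0,1\}\times\mathbb{N})$; - $(U_i)^{\mathcal{M}_c}=\{(0,i)\}$ and $(V_i)^{\mathcal{M}_c}=\{(1,i)\}$ for $i\in\mathbb{N}$; - $i\in(X_{e_i})^{\mathcal{M}_c}$ for $i\in\mathbb{N}$ (so that $(X_e)^{\mathcal{M}_c}=\{i : e_i=e\}\cup\{(0,e),(1,e)\}$ for each $e\in\mathbb{N}$). Then there is a computable set $\Xi$ of quantifier-free first-order $\mathcal{L}_c$-formulas such that if $\mathcal{N} \cong \mathcal{M}_c$, then uniformly in $\mathcal{N}$ we can compute $\mathrm{Fin}$ from $\mathrm{acl}_{\Xi, \mathcal{N}}$ via a $1$-reduction relative to $\mathcal{N}$. In particular, for computable such $\mathcal{N}$, the set $\mathrm{acl}_{\Xi, \mathcal{N}}$ is $\Sigma^0_2$-complete.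
   Context: Computable structures. Languages are relational and may be many-sorted: $\mathcal{L} = ((X_j)_{j\in J}, (R_i)_{i\in I})$ with sorts $X_j$ and relation symbols $R_i$, where $I,J\in\mathbb{N}\cup\{\mathbb{N}\}$ (a natural number is identified with the set of its predecessors). The type of a tuple of elements or variables is the product of the sorts of its entries, in order; the type of a relation symbol is a finite product of sorts. $\mathcal{L}$ is computable when the function sending $i\in I$ to $(j_0,\dots,j_{m-1})$, where $R_i$ has type $\prod_{k<m}X_{j_k}$, is computable; for each computable language a computable encoding of its first-order formulas is fixed. A computable $\mathcal{L}$-structure $\mathcal{N}$ has a computable underlying set, and $\{(a,j) : a\in (X_j)^{\mathcal{N}}\}$ and $\{(\overline{b},i) : \overline{b}\in (R_i)^{\mathcal{N}}\}$ are computable. Writing $\{e\}$ for the $e$th Turing machine, $c\in\mathbb{N}$ is a code for a structure if $\{c\}(0)$ is a code for a computable language, denoted $\mathcal{L}_c$, and $\{c\}(1)$ is a code for a computable $\mathcal{L}_c$-structure, denoted $\mathcal{M}_c$. $\mathrm{CompStr}$ is the set of all codes for structures. (The set $\mathbb{N}\cup(\{0,1\}\times\mathbb{N})$ is coded in $\mathbb{N}$ in a standard way.) Formulas $\varphi(\overline{x};\overline{y})$ come with a specified partition of their free variables; a set of formulas is a set of formulas with specified partitions. For a set $\Phi$ of first-order $\mathcal{L}$-formulas, an $\mathcal{L}$-structure $\mathcal{N}$ and $B\subseteq\mathcal{N}$: let $\mathrm{cl}^0(B):=B$; let $\mathrm{cl}^1(B)$ be $B$ together with all $b\in\mathcal{N}$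 for which there are $\varphi(\overline{x};\overline{y})\in\Phi$ and a tuple $\overline{a}$ from $B$ such that $\{\overline{d} : \mathcal{N}\models\varphi(\overline{a};\overline{d})\}$ is finite, and a tuple $\overline{b}\in\mathcal{N}$ having $b$ as an entry with $\mathcal{N}\models\varphi(\overline{a};\overline{b})$; let $\mathrm{cl}^{m+1}(B):=\mathrm{cl}^1(\mathrm{cl}^m(B))$; and let $\mathrm{acl}_{\Phi,\mathcal{N}}(B):=\bigcup_m\mathrm{cl}^m(B)$. As a set, $\mathrm{acl}_{\Phi,\mathcal{N}}:=\{(a,A) : A\subseteq\mathcal{N}\text{ finite},\ a\in\mathrm{acl}_{\Phi,\mathcal{N}}(A)\}$. $\mathrm{Fin}:=\{e\in\mathbb{N} : W_e\text{ is finite}\}$, where $W_e=\{n : \{e\}(n)\text{ converges}\}$. Here $\mathcal{N}$ is a structure presented on a set of natural numbers; ''uniformly in $\mathcal{N}$'' means by a single procedure having (the atomic diagram of) $\mathcal{N}$ as an oracle, and a $1$-reduction relative to $\mathcal{N}$ is an injective many-one reduction computable from $\mathcal{N}$. *)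

(* Defs.v *)
From Stdlib Require Import Arith List.
From Stdlib Require Cantor.
Import ListNotations.

Definition set := nat -> Prop.

Definition finite {T : Type} (P : T -> Prop) : Prop :=
  exists l : list T, forall x, P x -> In x l.

Definition pair (x y : nat) : nat := Cantor.to_nat (x, y).

Fixpoint list_code (l : list nat) : nat :=
  match l with
  | [] => 0
  | x :: l' => S (pair x (list_code l'))
  end.

(* The finite set with canonical index u, u being the sum of 2^x over its
   elements x. *)
Definition canonical (u : nat) : set := fun x => Nat.testbit u x = true.

(** * Computability relative to an oracle *)

(* Machines are given by Kleene's schemes for the functions partial recursive
   in an oracle, on unary functions: a k-ary function takes its arguments
   packed by [pair]. *)
Inductive program : Type :=
| Zero
| Succ
| Fst
| Snd
| Query
| Pair (f g : program)
| Comp (f g : program)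
| Prec (f g : program)
| Mu (f : program).

(* [eval O f x y]: with oracle O, f converges on input x with output y. *)
Fixpoint eval (O : set) (f : program) (x y : nat) : Prop :=
  match f with
  | Zero => y = 0
  | Succ => y = S x
  | Fst => y = fst (Cantor.of_nat x)
  | Snd => y = snd (Cantor.of_nat x)
  | Query => (O x /\ y = 1) \/ (~ O x /\ y = 0)
  | Pair f g => exists u v, eval O f x u /\ eval O g x v /\ y = pair u v
  | Comp f g => exists z, eval O g x z /\ eval O f z y
  | Prec f g =>
      (* h(a,0) = f(a);  h(a,i+1) = g(a,(i,h(a,i))) *)
      let a := fst (Cantor.of_nat x) in
      nat_rect (fun _ => nat -> Prop)
        (fun r => eval O f a r)
        (fun i h r => exists r', h r' /\ eval O g (pair a (pair i r')) r)
        (snd (Cantor.of_nat x)) y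
  | Mu f =>
      (* least y with f(x,y) = 0, all earlier values being defined *)
      eval O f (pair x y) 0 /\
      forall m, m < y -> exists k, eval O f (pair x m) (S k)
  end.

Fixpoint program_code (f : program) : nat :=
  match f with
  | Zero => pair 0 0
  | Succ => pair 1 0
  | Fst => pair 2 0
  | Snd => pair 3 0
  | Query => pair 4 0
  | Pair f g => pair 5 (pair (program_code f) (program_code g))
  | Comp f g => pair 6 (pair (program_code f) (program_code g))
  | Prec f g => pair 7 (pair (program_code f) (program_code g))
  | Mu f => pair 8 (program_code f)
  end.

(* [run e n y]: {e}(n) converges with output y, without oracle.  A number e
   that is not a program code denotes the nowhere defined function. *)
Definition run (e n y : nat) : Prop :=
  exists f, program_code f = e /\ eval (fun _ => False) f n y.

Definition converges (e n : nat) : Prop := exists y, run e n y.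

Definition Fin : set := fun e => finite (converges e).

Definition computes (O : set) (p : program) (f : nat -> nat) : Prop :=
  forall n, eval O p n (f n).

Definition computable_fun (f : nat -> nat) : Prop :=
  exists e, forall n, run e n (f n).

Definition decides (e : nat) (A : set) : Prop :=
  forall n, (A n /\ run e n 1) \/ (~ A n /\ run e n 0).

Definition computable_set (A : set) : Prop := exists e, decides e A.

(* f is a 1-reduction of A to B; its computability is stated separately. *)
Definition one_reduction (f : nat -> nat) (A B : set) : Prop :=
  (forall m n, f m = f n -> m = n) /\ forall n, A n <-> B (f n).

Definition Sigma02 (A : set) : Prop :=
  exists R : set, computable_set R /\
    forall x, A x <-> exists y, forall z, R (pair x (pair y z)).

Definition Sigma02_complete (A : set) : Prop :=
  Sigma02 A /\
  forall B, Sigma02 B -> exists f, computable_fun f /\ one_reduction f B A.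

(** * Languages and structures *)

(* An element of N \cup {N}; [Below n] is n = {0,...,n-1}. *)
Inductive index_set : Type :=
| AllNat
| Below (n : nat).

Definition in_index (J : index_set) : set :=
  fun j => match J with AllNat => True | Below n => j < n end.

Definition index_set_code (J : index_set) : nat :=
  match J with AllNat => 0 | Below n => S n end.

(* The value of [rel_type] outside [rels] is irrelevant. *)
Record language : Type := Language {
  sorts : index_set;
  rels : index_set;
  rel_type : nat -> list nat
}.

Definition is_language (L : language) : Prop :=
  forall i, in_index (rels L) i -> Forall (in_index (sorts L)) (rel_type L i).

(* Structures are presented on sets of natural numbers. *)
Record structure : Type := Structure {
  dom : set;
  sort : nat -> set;
  rel : nat -> list nat -> Prop
}.

(* [tuple_of N t a]: a is a tuple of N of type t. *)
Definition tuple_of (N : structure) (t a : list nat) : Prop :=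
  Forall2 (sort N) t a.

(* Every element belongs to exactly one sort. *)
Definition is_structure (L : language) (N : structure) : Prop :=
  (forall j a, sort N j a -> in_index (sorts L) j /\ dom N a) /\
  (forall a, dom N a -> exists! j, sort N j a) /\
  (forall i b, rel N i b ->
     in_index (rels L) i /\ tuple_of N (rel_type L i) b).

Definition sort_set (N : structure) : set :=
  fun m => exists a j, m = pair a j /\ sort N j a.

Definition rel_set (N : structure) : set :=
  fun m => exists b i, m = pair (list_code b) i /\ rel N i b.

(* The atomic diagram, as the join of the underlying set, the sorts and the
   relations. *)
Definition diagram (N : structure) : set :=
  fun m =>
    (exists a, m = pair 0 a /\ dom N a) \/
    (exists a, m = pair 1 a /\ sort_set N a) \/
    (exists a, m = pair 2 a /\ rel_set N a).

Definition isomorphic (N M : structure) : Prop :=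
  exists f : nat -> nat,
    (forall a, dom N a -> dom M (f a)) /\
    (forall a a', dom N a -> dom N a' -> f a = f a' -> a = a') /\
    (forall b, dom M b -> exists a, dom N a /\ f a = b) /\
    (forall j a, dom N a -> (sort N j a <-> sort M j (f a))) /\
    (forall i b, Forall (dom N) b -> (rel N i b <-> rel M i (map f b))).

(* l codes the computable language L. *)
Definition codes_language (l : nat) (L : language) : Prop :=
  is_language L /\
  exists t,
    l = pair (index_set_code (sorts L)) (pair (index_set_code (rels L)) t) /\
    forall i, in_index (rels L) i -> run t i (list_code (rel_type L i)).

(* s codes the computable L-structure N. *)
Definition codes_computable_structure
    (s : nat) (L : language) (N : structure) : Prop :=
  is_structure L N /\
  exists d p q,
    s = pair d (pair p q) /\
    decides d (dom N) /\ decides p (sort_set N) /\ decides q (rel_set N).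

Definition computable_structure (L : language) (N : structure) : Prop :=
  exists s, codes_computable_structure s L N.

(* c is in CompStr, with L_c = L and M_c = M. *)
Definition CompStr_code (c : nat) (L : language) (M : structure) : Prop :=
  exists l s, run c 0 l /\ run c 1 s /\
    codes_language l L /\ codes_computable_structure s L M.

(* The set N \cup ({0,1} x N) and its coding in N. *)
Inductive elt : Type :=
| Num (n : nat)
| Pt (b : bool) (n : nat).

Definition elt_code (x : elt) : nat :=
  match x with
  | Num n => 3 * n
  | Pt false n => 3 * n + 1
  | Pt true n => 3 * n + 2
  end.

(** * First-order formulas *)

(* (j, k) is the k-th variable of sort j. *)
Definition var : Type := (nat * nat)%type.

Definition var_eqb (x y : var) : bool :=
  (Nat.eqb (fst x) (fst y) && Nat.eqb (snd x) (snd y))%bool.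

Inductive formula : Type :=
| Falsum
| Equal (x y : var)
| Rel (i : nat) (xs : list var)
| Neg (f : formula)
| And (f g : formula)
| Or (f g : formula)
| Imp (f g : formula)
| Ex (x : var) (f : formula)
| All (x : var) (f : formula).

Fixpoint is_formula (L : language) (f : formula) : Prop :=
  match f with
  | Falsum => True
  | Equal x y => fst x = fst y /\ in_index (sorts L) (fst x)
  | Rel i xs => in_index (rels L) i /\ map fst xs = rel_type L i
  | Neg f => is_formula L f
  | And f g | Or f g | Imp f g => is_formula L f /\ is_formula L g
  | Ex x f | All x f => in_index (sorts L) (fst x) /\ is_formula L f
  end.

Fixpoint quantifier_free (f : formula) : Prop :=
  match f with
  | Falsum | Equal _ _ | Rel _ _ => True
  | Neg f => quantifier_free f
  | And f g | Or f g | Imp f g => quantifier_free f /\ quantifier_free g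
  | Ex _ _ | All _ _ => False
  end.

Fixpoint free_in (x : var) (f : formula) : Prop :=
  match f with
  | Falsum => False
  | Equal y z => x = y \/ x = z
  | Rel _ xs => In x xs
  | Neg f => free_in x f
  | And f g | Or f g | Imp f g => free_in x f \/ free_in x g
  | Ex y f | All y f => x <> y /\ free_in x f
  end.

Definition update (v : var -> nat) (x : var) (a : nat) : var -> nat :=
  fun y => if var_eqb y x then a else v y.

Fixpoint sat (N : structure) (v : var -> nat) (f : formula) : Prop :=
  match f with
  | Falsum => False
  | Equal x y => v x = v y
  | Rel i xs => rel N i (map v xs)
  | Neg f => ~ sat N v f
  | And f g => sat N v f /\ sat N v g
  | Or f g => sat N v f \/ sat N v g
  | Imp f g => sat N v f -> sat N v g
  | Ex x f => exists a, sort N (fst x) a /\ sat N (update v x a) f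
  | All x f => forall a, sort N (fst x) a -> sat N (update v x a) f
  end.

(* A formula phi(xs; ys) with a partition of its free variables. *)
Record pformula : Type := PFormula {
  xvars : list var;
  yvars : list var;
  body : formula
}.

Definition is_pformula (L : language) (p : pformula) : Prop :=
  is_formula L (body p) /\
  NoDup (xvars p ++ yvars p) /\
  forall x, In x (xvars p ++ yvars p) <-> free_in x (body p).

(* [holds N p a d]: a and d are tuples of N of the types of xs and ys, and
   N satisfies phi(a; d). *)
Definition holds (N : structure) (p : pformula) (a d : list nat) : Prop :=
  tuple_of N (map fst (xvars p)) a /\
  tuple_of N (map fst (yvars p)) d /\
  exists v : var -> nat,
    map v (xvars p) = a /\ map v (yvars p) = d /\ sat N v (body p).

Definition var_code (x : var) : nat := pair (fst x) (snd x).

Definition vars_code (xs : list var) : nat := list_code (map var_code xs).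

Fixpoint formula_code (f : formula) : nat :=
  match f with
  | Falsum => pair 0 0
  | Equal x y => pair 1 (pair (var_code x) (var_code y))
  | Rel i xs => pair 2 (pair i (vars_code xs))
  | Neg f => pair 3 (formula_code f)
  | And f g => pair 4 (pair (formula_code f) (formula_code g))
  | Or f g => pair 5 (pair (formula_code f) (formula_code g))
  | Imp f g => pair 6 (pair (formula_code f) (formula_code g))
  | Ex x f => pair 7 (pair (var_code x) (formula_code f))
  | All x f => pair 8 (pair (var_code x) (formula_code f))
  end.

Definition pformula_code (p : pformula) : nat :=
  pair (vars_code (xvars p)) (pair (vars_code (yvars p)) (formula_code (body p))).

Definition computable_formulas (Phi : pformula -> Prop) : Prop :=
  computable_set (fun n => exists p, Phi p /\ n = pformula_code p).

(** * Algebraic closure *)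

Definition cl1 (Phi : pformula -> Prop) (N : structure) (B : set) : set :=
  fun b =>
    B b \/
    exists p a,
      Phi p /\ Forall B a /\ finite (holds N p a) /\
      exists bs, holds N p a bs /\ In b bs.

Fixpoint cl (Phi : pformula -> Prop) (N : structure) (m : nat) (B : set) : set :=
  match m with
  | 0 => B
  | S m => cl1 Phi N (cl Phi N m B)
  end.

Definition acl (Phi : pformula -> Prop) (N : structure) (B : set) : set :=
  fun b => exists m, cl Phi N m B b.

(* acl as the set of pairs (a, A) with A finite, A given by its canonical
   index. *)
Definition acl_set (Phi : pformula -> Prop) (N : structure) : set :=
  fun n => exists a u,
    n = pair a u /\
    (forall x, canonical u x -> dom N x) /\
    acl Phi N (canonical u) a.

(* Main.v *)
Require Import Defs.
From Stdlib Require Import Arith List Lia Classical ClassicalEpsilon.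
From Stdlib Require Cantor.
Import ListNotations.

(** The set of formulas is [sort_formulas]: for each sort [X_e] the formula
    [y = y] in one variable of that sort, with an empty tuple of parameters.
    Its set of solutions is the whole sort, so one closure step adds exactly
    the elements of the finite sorts and further steps add nothing
    ([acl_sort_formulas]).  In [M] the sort [X_e] consists of two points and
    one element for each [n] at which [{e}] converges, so it is finite exactly
    when [e] is in [Fin] ([finite_sort_iff_Fin]), and isomorphisms preserve
    this.  Hence [e] is in [Fin] if and only if one fixed element of the sort
    [X_e] is algebraic over the empty set.  Such an element is found from the
    atomic diagram: each [U_e] and [V_e] holds of exactly one element, so the
    search for a relation symbol of type [[e]], and then for an element
    satisfying it, terminates.  Different [e] give elements of different sorts,
    so the reduction is injective ([one_reduction_acl]).

    For a computable structure, [acl] is in the class Sigma^0_2 because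
    finiteness of a sort says that some number bounds all its elements
    ([Sigma02_acl]).  Completeness follows by composing the reduction with the
    classical hardness of [Fin] ([Fin_hard]): given
    [B = {x : exists y, forall z, R(x,y,z)}], the program that on input [n]
    searches, for each [y < n] in turn, for some [z] with [~ R(x,y,z)] has a
    finite domain exactly when [x] is in [B], and its code is an injective
    computable function of [x].

    All uniformity is carried by [computable_in]: a family of functions indexed
    by [i] that one program computes, for each [i] from the oracle [O i].  The
    closure properties of such families replace the writing of programs, except
    for the partial program used in [Fin_hard].  A set relative to an oracle is
    handled as the zero set of such a family, which is what the operator [Mu]
    searches for. *)

(** * Codes *)

Definition pi1 (n : nat) : nat := fst (Cantor.of_nat n).
Definition pi2 (n : nat) : nat := snd (Cantor.of_nat n).

#[local] Arguments pair : simpl never.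
#[local] Arguments pi1 : simpl never.
#[local] Arguments pi2 : simpl never.

Lemma pi1_pair x y : pi1 (pair x y) = x.
Proof. unfold pi1, pair. now rewrite Cantor.cancel_of_to. Qed.

Lemma pi2_pair x y : pi2 (pair x y) = y.
Proof. unfold pi2, pair. now rewrite Cantor.cancel_of_to. Qed.

Lemma pair_pi n : pair (pi1 n) (pi2 n) = n.
Proof.
  unfold pi1, pi2, pair.
  rewrite <- surjective_pairing. apply Cantor.cancel_to_of.
Qed.

Lemma pair_inj x y x' y' : pair x y = pair x' y' -> x = x' /\ y = y'.
Proof.
  intros H. split.
  - now rewrite <- (pi1_pair x y), H, pi1_pair.
  - now rewrite <- (pi2_pair x y), H, pi2_pair.
Qed.

Lemma list_code_inj l l' : list_code l = list_code l' -> l = l'.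
Proof.
  revert l'; induction l as [|x l IH]; intros [|x' l']; simpl; try discriminate.
  - reflexivity.
  - intros [= H]. apply pair_inj in H as [-> H]. f_equal. now apply IH.
Qed.

Lemma program_code_inj p q : program_code p = program_code q -> p = q.
Proof.
  revert q; induction p; intros q; destruct q; simpl; intros H;
    apply pair_inj in H as [H1 H2]; try discriminate H1; try reflexivity;
    try (apply pair_inj in H2 as [H2 H3]); f_equal; auto.
Qed.

(** * Evaluation of programs *)

(** Since [run] and [computes] speak of outputs as a relation, every converse
    reading of a computation rests on this. *)
Lemma eval_functional O p x y y' : eval O p x y -> eval O p x y' -> y = y'.
Proof.
  revert x y y'; induction p as [| | | | |p IHp q IHq|p IHp q IHq|p IHp q IHq|p IHp];
    intros x y y'; cbn [eval].
  1-4: congruence.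
  - intros [[H ->]|[H ->]] [[H' ->]|[H' ->]]; tauto.
  - intros (u & v & Hu & Hv & ->) (u' & v' & Hu' & Hv' & ->).
    now rewrite (IHp _ _ _ Hu Hu'), (IHq _ _ _ Hv Hv').
  - intros (z & Hz & Hy) (z' & Hz' & Hy').
    rewrite (IHq _ _ _ Hz Hz') in Hy. eauto.
  - revert y y'. generalize (snd (Cantor.of_nat x)) as n.
    induction n as [|n IHn]; simpl; intros y y'.
    + apply IHp.
    + intros (r & Hr & Hy) (r' & Hr' & Hy').
      rewrite (IHn _ _ Hr Hr') in Hy. eauto.
  - intros [H0 Hlt] [H0' Hlt'].
    destruct (lt_eq_lt_dec y y') as [[H|H]|H]; trivial; exfalso.
    + destruct (Hlt' _ H) as [k Hk]. discriminate (IHp _ _ _ H0 Hk).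
    + destruct (Hlt _ H) as [k Hk]. discriminate (IHp _ _ _ H0' Hk).
Qed.

Lemma computes_eval O p f x y : computes O p f -> eval O p x y <-> y = f x.
Proof.
  intros H; split.
  - intros Hy. exact (eval_functional _ _ _ _ _ Hy (H x)).
  - intros ->. apply H.
Qed.

Lemma eval_comp O p q g x y :
  computes O q g -> eval O (Comp p q) x y <-> eval O p (g x) y.
Proof.
  intros Hq. cbn [eval]. split.
  - intros (z & Hz & Hy). apply (computes_eval _ _ _ _ _ Hq) in Hz as ->. exact Hy.
  - intros Hy. exists (g x). split; [apply Hq|exact Hy].
Qed.

Lemma eval_mu_zero O p f x z :
  computes O p f -> eval O (Mu p) x z -> f (pair x z) = 0.
Proof.
  intros Hp [H _]. symmetry. now apply (computes_eval O p f).
Qed.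

Lemma eval_mu_total O p f x z :
  computes O p f -> f (pair x z) = 0 -> exists z', eval O (Mu p) x z'.
Proof.
  intros Hp. induction z as [z IH] using (well_founded_induction lt_wf).
  intros Hz.
  destruct (classic (exists m, m < z /\ f (pair x m) = 0)) as [(m & Hm & H0)|Hmin].
  - exact (IH m Hm H0).
  - exists z. split.
    + rewrite <- Hz. apply Hp.
    + intros m Hm. exists (pred (f (pair x m))).
      rewrite Nat.succ_pred; [apply Hp|]. intros H0. apply Hmin. eauto.
Qed.

(** Relative computability is transitive: a program that decides the oracle can
    be put in place of the queries. *)
Fixpoint oracle_subst (q p : program) : program :=
  match p with
  | Query => q
  | Pair f g => Pair (oracle_subst q f) (oracle_subst q g)
  | Comp f g => Comp (oracle_subst q f) (oracle_subst q g)
  | Prec f g => Prec (oracle_subst q f) (oracle_subst q g)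
  | Mu f => Mu (oracle_subst q f)
  | _ => p
  end.

Lemma eval_oracle_subst O O' q :
  (forall x, (O x /\ eval O' q x 1) \/ (~ O x /\ eval O' q x 0)) ->
  forall p x y, eval O' (oracle_subst q p) x y <-> eval O p x y.
Proof.
  intros Hq p.
  induction p as [| | | | |p IHp r IHr|p IHp r IHr|p IHp r IHr|p IHp];
    intros x y; cbn [eval oracle_subst]; try reflexivity.
  - split.
    + intros H. destruct (Hq x) as [[HO H']|[HO H']];
        rewrite (eval_functional _ _ _ _ _ H H'); auto.
    + intros [[HO ->]|[HO ->]]; destruct (Hq x); tauto.
  - now setoid_rewrite IHp; setoid_rewrite IHr.
  - now setoid_rewrite IHp; setoid_rewrite IHr.
  - revert y. generalize (snd (Cantor.of_nat x)) as n.
    induction n as [|n IHn]; simpl; intros y.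
    + apply IHp.
    + now setoid_rewrite IHn; setoid_rewrite IHr.
  - now setoid_rewrite IHp.
Qed.

(** * Uniformly computable functions and decidable sets *)

(** Uniformity: the indices [i] will be the copies of a structure, and [O i]
    their diagrams, while [p] may not depend on [i]. *)
Definition computable_in {I : Type} (O : I -> set) (f : I -> nat -> nat) : Prop :=
  exists p, forall i, computes (O i) p (f i).

(** Membership is encoded by the value 0 so that conjunction is addition,
    negation is [1 - _], and [Mu] searches for a member. *)
Definition decidable_in {I : Type} (O A : I -> set) : Prop :=
  exists f, computable_in O f /\ forall i x, A i x <-> f i x = 0.

(** Choice is used only to pass from a total relation to a function; by
    determinism the function is the one that [p] computes. *)
Lemma computable_program {I : Type} (O : I -> set) (Q : I -> nat -> nat -> Prop) p :
  (forall i x, exists y, eval (O i) p x y /\ Q i x y) ->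
  exists f, computable_in O f /\ forall i x, Q i x (f i x).
Proof.
  intros H.
  pose (f i x := proj1_sig (constructive_indefinite_description _ (H i x))).
  assert (Hf : forall i x, eval (O i) p x (f i x) /\ Q i x (f i x)).
  { intros i x. unfold f. apply proj2_sig. }
  exists f. split.
  - exists p. intros i x. apply Hf.
  - intros i x. apply Hf.
Qed.

Section Closure.
Context {I : Type} {O : I -> set}.
Implicit Types (f g h : I -> nat -> nat) (A B : I -> set).

Lemma computable_ext f g :
  (forall i x, f i x = g i x) -> computable_in O f -> computable_in O g.
Proof.
  intros E [p Hp]. exists p. intros i x. rewrite <- E. apply Hp.
Qed.

Lemma computable_id : computable_in O (fun _ x => x).
Proof.
  exists (Pair Fst Snd). intros i x. exists (pi1 x), (pi2 x).
  repeat split. symmetry. apply pair_pi.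
Qed.

Lemma computable_comp f g :
  computable_in O f -> computable_in O g -> computable_in O (fun i x => f i (g i x)).
Proof.
  intros [p Hp] [q Hq]. exists (Comp p q). intros i x. exists (g i x).
  split; [apply Hq|apply Hp].
Qed.

Lemma computable_succ f : computable_in O f -> computable_in O (fun i x => S (f i x)).
Proof.
  apply (computable_comp (fun _ x => S x)). exists Succ. intros i x. reflexivity.
Qed.

Lemma computable_pi1 f : computable_in O f -> computable_in O (fun i x => pi1 (f i x)).
Proof.
  apply (computable_comp (fun _ x => pi1 x)). exists Fst. intros i x. reflexivity.
Qed.

Lemma computable_pi2 f : computable_in O f -> computable_in O (fun i x => pi2 (f i x)).
Proof.
  apply (computable_comp (fun _ x => pi2 x)). exists Snd. intros i x. reflexivity.
Qed.

Lemma computable_pair f g :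
  computable_in O f -> computable_in O g ->
  computable_in O (fun i x => pair (f i x) (g i x)).
Proof.
  intros [p Hp] [q Hq]. exists (Pair p q). intros i x. exists (f i x), (g i x).
  repeat split; [apply Hp|apply Hq].
Qed.

Lemma computable_const k : computable_in O (fun _ _ => k).
Proof.
  induction k as [|k IH].
  - exists Zero. intros i x. reflexivity.
  - now apply computable_succ.
Qed.

(** The recursion formula is a hypothesis on [h], rather than [h] being a
    [nat_rect], because unpacking the argument of [step] is not a conversion. *)
Lemma computable_rec (h : I -> nat -> nat -> nat) base step count :
  computable_in O base -> computable_in O step -> computable_in O count ->
  (forall i x, h i x 0 = base i x) ->
  (forall i x n, h i x (S n) = step i (pair x (pair n (h i x n)))) ->
  computable_in O (fun i x => h i x (count i x)).
Proof.
  intros [p Hp] [q Hq] Hcount H0 HS.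
  assert (Hh : computable_in O (fun i x => h i (pi1 x) (pi2 x))).
  { exists (Prec p q). intros i x. cbn [eval].
    fold (pi1 x); fold (pi2 x). generalize (pi2 x) as n.
    induction n as [|n IH]; simpl.
    - rewrite H0. apply Hp.
    - exists (h i (pi1 x) n). split; [exact IH|]. rewrite HS. apply Hq. }
  apply (computable_comp _ (fun i x => pair x (count i x))) in Hh.
  - revert Hh. apply computable_ext. intros i x. now rewrite pi1_pair, pi2_pair.
  - apply computable_pair; [apply computable_id|assumption].
Qed.
End Closure.

Create HintDb comp.
#[global] Hint Resolve computable_id computable_succ computable_pi1 computable_pi2
  computable_pair computable_const : comp.

Section Arithmetic.
Context {I : Type} {O : I -> set}.
Implicit Types (f g : I -> nat -> nat) (A B : I -> set).

Lemma computable_add f g :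
  computable_in O f -> computable_in O g -> computable_in O (fun i x => f i x + g i x).
Proof.
  intros Hf Hg.
  apply (computable_rec (fun i x n => f i x + n) f (fun _ w => S (pi2 (pi2 w))) g);
    auto with comp.
  intros i x n. now rewrite !pi2_pair.
Qed.

Lemma computable_pred f : computable_in O f -> computable_in O (fun i x => pred (f i x)).
Proof.
  intros Hf.
  apply (computable_rec (fun _ _ n => pred n)
    (fun _ _ => 0) (fun _ w => pi1 (pi2 w)) f); auto with comp.
  intros i x n. now rewrite pi2_pair, pi1_pair.
Qed.

Lemma computable_sub f g :
  computable_in O f -> computable_in O g -> computable_in O (fun i x => f i x - g i x).
Proof.
  intros Hf Hg.
  apply (computable_rec (fun i x n => f i x - n) f (fun _ w => pred (pi2 (pi2 w))) g);
    auto using computable_pred with comp.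
  - intros i x. apply Nat.sub_0_r.
  - intros i x n. rewrite !pi2_pair. apply Nat.sub_succ_r.
Qed.

Lemma computable_odd f :
  computable_in O f -> computable_in O (fun i x => Nat.b2n (Nat.odd (f i x))).
Proof.
  intros Hf.
  apply (computable_rec (fun _ _ n => Nat.b2n (Nat.odd n))
    (fun _ _ => 0) (fun _ w => 1 - pi2 (pi2 w)) f);
    auto using computable_sub with comp.
  intros i x n. rewrite !pi2_pair, Nat.odd_succ, <- Nat.negb_odd.
  now destruct (Nat.odd n).
Qed.

Lemma computable_div2 f :
  computable_in O f -> computable_in O (fun i x => Nat.div2 (f i x)).
Proof.
  intros Hf.
  apply (computable_rec (fun _ _ n => Nat.div2 n) (fun _ _ => 0)
    (fun _ w => pi2 (pi2 w) + Nat.b2n (Nat.odd (pi1 (pi2 w)))) f);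
    auto using computable_add, computable_odd with comp.
  intros i x n. rewrite !pi2_pair, pi1_pair.
  generalize (Nat.div2_odd n) (Nat.div2_odd (S n)).
  rewrite Nat.odd_succ, <- Nat.negb_odd.
  destruct (Nat.odd n); simpl Nat.b2n; lia.
Qed.

Lemma computable_testbit f g :
  computable_in O f -> computable_in O g ->
  computable_in O (fun i x => Nat.b2n (Nat.testbit (f i x) (g i x))).
Proof.
  intros Hf Hg.
  assert (Hs : computable_in O (fun i x => Nat.shiftr (f i x) (g i x))).
  { apply (computable_rec (fun i x n => Nat.shiftr (f i x) n) f
      (fun _ w => Nat.div2 (pi2 (pi2 w))) g); auto using computable_div2 with comp.
    intros i x n. now rewrite !pi2_pair. }
  apply computable_odd in Hs. revert Hs. apply computable_ext.
  intros i x. now rewrite <- Nat.bit0_odd, Nat.shiftr_spec'.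
Qed.

Lemma decidable_ext A B :
  (forall i x, A i x <-> B i x) -> decidable_in O A -> decidable_in O B.
Proof.
  intros E (f & Hf & HA). exists f. split; [exact Hf|].
  intros i x. now rewrite <- E.
Qed.

Lemma decidable_comp A f :
  decidable_in O A -> computable_in O f -> decidable_in O (fun i x => A i (f i x)).
Proof.
  intros (g & Hg & HA) Hf. exists (fun i x => g i (f i x)). split.
  - now apply computable_comp.
  - intros i x. apply HA.
Qed.

Lemma decidable_le f g :
  computable_in O f -> computable_in O g -> decidable_in O (fun i x => f i x <= g i x).
Proof.
  intros Hf Hg. exists (fun i x => f i x - g i x). split.
  - now apply computable_sub.
  - intros i x. lia.
Qed.

Lemma decidable_and A B :
  decidable_in O A -> decidable_in O B -> decidable_in O (fun i x => A i x /\ B i x).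
Proof.
  intros (f & Hf & HA) (g & Hg & HB). exists (fun i x => f i x + g i x). split.
  - now apply computable_add.
  - intros i x. rewrite HA, HB. lia.
Qed.

Lemma decidable_not A : decidable_in O A -> decidable_in O (fun i x => ~ A i x).
Proof.
  intros (f & Hf & HA). exists (fun i x => 1 - f i x). split.
  - apply computable_sub; auto with comp.
  - intros i x. rewrite HA. lia.
Qed.

Lemma decidable_or A B :
  decidable_in O A -> decidable_in O B -> decidable_in O (fun i x => A i x \/ B i x).
Proof.
  intros HA HB. apply (decidable_ext (fun i x => ~ (~ A i x /\ ~ B i x))).
  - intros i x. tauto.
  - auto using decidable_not, decidable_and.
Qed.

Lemma decidable_imp A B :
  decidable_in O A -> decidable_in O B -> decidable_in O (fun i x => A i x -> B i x).
Proof.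
  intros HA HB. apply (decidable_ext (fun i x => ~ A i x \/ B i x)).
  - intros i x. tauto.
  - auto using decidable_not, decidable_or.
Qed.

Lemma decidable_eq f g :
  computable_in O f -> computable_in O g -> decidable_in O (fun i x => f i x = g i x).
Proof.
  intros Hf Hg. apply (decidable_ext (fun i x => f i x <= g i x /\ g i x <= f i x)).
  - intros i x. lia.
  - auto using decidable_and, decidable_le.
Qed.

Lemma decidable_testbit f g :
  computable_in O f -> computable_in O g ->
  decidable_in O (fun i x => Nat.testbit (f i x) (g i x) = true).
Proof.
  intros Hf Hg.
  apply (decidable_ext (fun i x => Nat.b2n (Nat.testbit (f i x) (g i x)) = 1)).
  - intros i x. destruct (Nat.testbit (f i x) (g i x)); simpl; split; congruence.
  - apply decidable_eq; auto using computable_testbit with comp.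
Qed.

(** The zero-set encoding agrees with the usual one, by a program with output 1
    on members and 0 elsewhere. *)
Lemma decidable_in_iff A :
  decidable_in O A <->
  exists p, forall i x,
    (A i x /\ eval (O i) p x 1) \/ (~ A i x /\ eval (O i) p x 0).
Proof.
  split.
  - intros (f & Hf & HA).
    assert (Hc : computable_in O (fun i x => 1 - f i x))
      by (apply computable_sub; auto with comp).
    destruct Hc as [p Hp]. exists p. intros i x. specialize (Hp i x). cbn in Hp.
    rewrite HA. destruct (f i x) as [|k]; [left|right]; split; try easy.
  - intros [p Hp].
    destruct (computable_program O
      (fun i x y => (A i x /\ y = 1) \/ (~ A i x /\ y = 0)) p) as (f & Hf & HA).
    { intros i x. destruct (Hp i x) as [[]|[]]; eauto. }
    apply (decidable_ext (fun i x => f i x = 1)).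
    + intros i x. destruct (HA i x) as [[H ->]|[H ->]]; split; try tauto; discriminate.
    + apply decidable_eq; auto with comp.
Qed.

Lemma decidable_oracle : decidable_in O O.
Proof.
  apply decidable_in_iff. exists Query. intros i x. cbn.
  destruct (classic (O i x)); tauto.
Qed.

(** How symbols and elements known only to exist are found from a diagram. *)
Lemma computable_search A :
  decidable_in O A -> (forall i x, exists y, A i (pair x y)) ->
  exists f, computable_in O f /\ forall i x, A i (pair x (f i x)).
Proof.
  intros (f & [p Hp] & HA) Hex. apply (computable_program O (fun i x y => A i (pair x y)) (Mu p)).
  intros i x. destruct (Hex i x) as [z Hz]. apply HA in Hz.
  destruct (eval_mu_total _ _ _ _ _ (Hp i) Hz) as [z' Hz'].
  exists z'. split; [exact Hz'|]. apply HA. exact (eval_mu_zero _ _ _ _ _ (Hp i) Hz').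
Qed.

End Arithmetic.

Lemma computable_change_oracle {I : Type} (O O' : I -> set) f :
  decidable_in O' O -> computable_in O f -> computable_in O' f.
Proof.
  rewrite decidable_in_iff. intros [q Hq] [p Hp].
  exists (oracle_subst q p). intros i x.
  apply (eval_oracle_subst (O i)); [apply Hq|apply Hp].
Qed.

(** * Absolute computability *)

Definition no_oracle {I : Type} : I -> set := fun _ _ => False.

(** [run] allows a different program with code [e] at each input; injectivity of
    the coding makes it the same one throughout. *)
Lemma computable_fun_iff f :
  computable_fun f <-> computable_in (I := unit) no_oracle (fun _ => f).
Proof.
  split.
  - intros [e He]. destruct (He 0) as (p & Hp & _). exists p. intros i n.
    destruct (He n) as (q & Hq & Hy). rewrite <- Hp in Hq.
    apply program_code_inj in Hq as ->. exact Hy.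
  - intros [p Hp]. exists (program_code p). intros n. exists p.
    split; [reflexivity|apply (Hp tt)].
Qed.

Lemma computable_set_iff A :
  computable_set A <-> decidable_in (I := unit) no_oracle (fun _ => A).
Proof.
  rewrite decidable_in_iff. split.
  - intros [e He].
    assert (Hp : exists p, program_code p = e)
      by (destruct (He 0) as [[_ (p & Hp & _)]|[_ (p & Hp & _)]]; eauto).
    destruct Hp as [p <-]. exists p. intros i n.
    destruct (He n) as [[HA (q & Hq & Hy)]|[HA (q & Hq & Hy)]];
      apply program_code_inj in Hq as ->; auto.
  - intros [p Hp]. exists (program_code p). intros n.
    destruct (Hp tt n) as [[HA Hy]|[HA Hy]]; [left|right];
      (split; [exact HA|exists p; split; [reflexivity|exact Hy]]).
Qed.

Lemma computable_fun_in {I : Type} (O : I -> set) f :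
  computable_fun f -> computable_in O (fun _ => f).
Proof.
  intros Hf. apply (computable_change_oracle no_oracle).
  - apply decidable_in_iff. exists Zero. intros i x. right. split; [tauto|reflexivity].
  - apply computable_fun_iff in Hf as [p Hp]. exists p. intros i. apply (Hp tt).
Qed.

(** * The set Fin is hard for the class of existential-universal sets *)

Fixpoint const_program (k : nat) : program :=
  match k with
  | 0 => Zero
  | S k => Comp Succ (const_program k)
  end.

(** The s-m-n construction: [p] with the first component of its argument fixed.
    [Pair Fst Snd] is the identity. *)
Definition specialize (p : program) (x : nat) : program :=
  Comp p (Pair (const_program x) (Pair Fst Snd)).

Lemma computes_const_program O k : computes O (const_program k) (fun _ => k).
Proof.
  intros n. induction k as [|k IH]; simpl; [reflexivity|]. now exists k.
Qed.

Lemma eval_specialize O p x n y :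
  eval O (specialize p x) n y <-> eval O p (pair x n) y.
Proof.
  apply (eval_comp O p _ (fun n => pair x n)).
  intros m. exists x, m. repeat split; [apply computes_const_program|].
  exists (pi1 m), (pi2 m). repeat split. symmetry. apply pair_pi.
Qed.

Lemma specialize_inj p x x' : specialize p x = specialize p x' -> x = x'.
Proof.
  intros [= H]. revert x' H.
  induction x as [|x IH]; intros [|x']; simpl; try discriminate; [easy|].
  intros [= H]. f_equal. now apply IH.
Qed.

(** The code of [const_program] is computed by primitive recursion along its own
    definition, [pair 1 0] being the code of [Succ]. *)
Lemma computable_specialize p : computable_fun (fun x => program_code (specialize p x)).
Proof.
  apply computable_fun_iff.
  assert (H : computable_in (I := unit) no_oracle
                (fun _ x => program_code (const_program x))).
  { apply (computable_rec (fun _ _ n => program_code (const_program n))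
      (fun _ _ => pair 0 0)
      (fun _ w => pair 6 (pair (pair 1 0) (pi2 (pi2 w)))) (fun _ x => x));
      auto with comp.
    intros i x n. now rewrite !pi2_pair. }
  unfold specialize. cbn [program_code]. auto 10 with comp.
Qed.

Lemma finite_nat_iff (P : set) : finite P <-> exists b, forall x, P x -> x <= b.
Proof.
  split.
  - intros [l Hl]. exists (list_max l). intros x Hx.
    assert (H : Forall (fun k => k <= list_max l) l) by now apply list_max_le.
    rewrite Forall_forall in H. auto.
  - intros [b Hb]. exists (seq 0 (S b)). intros x Hx. apply in_seq.
    specialize (Hb x Hx). lia.
Qed.

Lemma Fin_program_code p :
  Fin (program_code p) <-> finite (fun n => exists y, eval (fun _ => False) p n y).
Proof.
  enough (E : forall n, converges (program_code p) n <->
                 exists y, eval (fun _ => False) p n y).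
  { unfold Fin, finite. now setoid_rewrite E. }
  intros n. split.
  - intros (y & q & Hq & Hy). apply program_code_inj in Hq as ->. eauto.
  - intros (y & Hy). exists y, p. auto.
Qed.

(** The domain of the program for [x] is an initial segment, which stops at the
    first [y] with [R(x,y,z)] for all [z] and is everything if there is none. *)
Lemma Fin_hard B :
  Sigma02 B -> exists f, computable_fun f /\ one_reduction f B Fin.
Proof.
  intros (R & HR & HB). apply computable_set_iff in HR.
  assert (Hq : decidable_in (I := unit) no_oracle
    (fun _ w => ~ R (pair (pi1 (pi1 w)) (pair (pi2 (pi1 w)) (pi2 w))))).
  { apply decidable_not. apply (decidable_comp (fun _ => R)); auto 10 with comp. }
  destruct Hq as (g & [q Hq] & Hg). specialize (Hq tt). specialize (Hg tt).
  (* The recursion on n runs the search for y = n - 1 after that for smaller y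
     and discards its result: the step keeps only x and y of (x, (y, result)). *)
  pose (p := Prec Zero (Comp (Mu q) (Pair Fst (Comp Fst Snd)))).
  assert (Hstep : forall x n r u,
    eval (fun _ => False) (Comp (Mu q) (Pair Fst (Comp Fst Snd)))
      (pair x (pair n r)) u <->
    eval (fun _ => False) (Mu q) (pair x n) u).
  { intros x n r u.
    rewrite (eval_comp _ _ _ (fun w => pair (pi1 w) (pi1 (pi2 w)))).
    - now rewrite pi2_pair, !pi1_pair.
    - intros w. exists (pi1 w), (pi1 (pi2 w)). repeat split. now exists (pi2 w). }
  assert (Hp : forall x n, (exists y, eval (fun _ => False) p (pair x n) y) <->
                 forall y, y < n -> exists z, ~ R (pair x (pair y z))).
  { intros x n. change p with (Prec Zero (Comp (Mu q) (Pair Fst (Comp Fst Snd)))).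
    cbn [eval]. fold (pi1 (pair x n)); fold (pi2 (pair x n)).
    rewrite pi1_pair, pi2_pair.
    induction n as [|n IH]; cbn [nat_rect].
    - split; [lia|eauto].
    - split.
      + intros (y & r & Hr & Hy) m Hm. apply Hstep in Hy.
        destruct (Nat.eq_dec m n) as [->|Hne].
        * exists y. apply (eval_mu_zero _ _ _ _ _ Hq), Hg in Hy.
          now rewrite pi1_pair, !pi2_pair, pi1_pair in Hy.
        * apply IH; [eauto|lia].
      + intros H. destruct (proj2 IH) as [r Hr]; [intros m Hm; apply H; lia|].
        destruct (H n) as [z Hz]; [lia|].
        destruct (eval_mu_total _ q (g tt) (pair x n) z Hq) as [u Hu].
        * apply Hg. now rewrite pi1_pair, !pi2_pair, pi1_pair.
        * exists u, r. split; [exact Hr|]. now apply Hstep. }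
  exists (fun x => program_code (specialize p x)).
  split; [apply computable_specialize|]. split.
  - intros x x' H. apply program_code_inj in H. now apply specialize_inj in H.
  - intros x. rewrite HB, Fin_program_code, finite_nat_iff.
    setoid_rewrite eval_specialize. setoid_rewrite Hp. split.
    + intros [y Hy]. exists y. intros n Hn.
      destruct (le_lt_dec n y) as [H|H]; [exact H|].
      destruct (Hn y H) as [z Hz]. now elim Hz.
    + intros [b Hb]. apply NNPP. intros Hno.
      enough (S b <= b) by lia. apply Hb. intros y _.
      apply not_all_ex_not. intros Hy. apply Hno. eauto.
Qed.

(** * Atomic diagrams *)

Lemma sort_set_pair N a j : sort_set N (pair a j) <-> sort N j a.
Proof.
  split; [|now exists a, j].
  intros (a' & j' & H & Ha). now apply pair_inj in H as [-> ->].
Qed.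

Lemma diagram_rel N b i : diagram N (pair 2 (pair (list_code b) i)) <-> rel N i b.
Proof.
  split.
  - intros [(a & H & _)|[(a & H & _)|(a & H & b' & i' & -> & Hb)]];
      apply pair_inj in H as [H1 H2]; try discriminate H1.
    apply pair_inj in H2 as [H2 ->]. now apply list_code_inj in H2 as ->.
  - intros H. right; right. eexists. split; [reflexivity|]. now exists b, i.
Qed.

Lemma computable_diagram L N : computable_structure L N -> computable_set (diagram N).
Proof.
  intros (s & _ & d & p & q & _ & Hd & Hp & Hq). apply computable_set_iff.
  assert (H : forall k (A : set), computable_set A ->
    decidable_in (I := unit) no_oracle (fun _ m => exists a, m = pair k a /\ A a)).
  { intros k A HA. apply computable_set_iff in HA.
    apply (decidable_ext (fun _ m => pi1 m = k /\ A (pi2 m))).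
    - intros i m. split.
      + intros [<- Hm]. exists (pi2 m). now rewrite pair_pi.
      + intros (a & -> & Ha). now rewrite pi1_pair, pi2_pair.
    - apply decidable_and.
      + apply decidable_eq; auto with comp.
      + apply (decidable_comp (fun _ => A)); auto with comp. }
  apply decidable_or; [|apply decidable_or]; apply H; eexists; eassumption.
Qed.

(** * Algebraic closure with respect to the formulas defining the sorts *)

(** The variable has sort [X_e], so this true equation defines the set of all
    elements of that sort. *)
Definition sort_formula (e : nat) : pformula :=
  PFormula [] [(e, 0)] (Equal (e, 0) (e, 0)).

Definition sort_formulas (p : pformula) : Prop := exists e, p = sort_formula e.

(** A number is a code of one of these formulas when it equals the code built
    from the sort that it mentions at the place of the variable [y]. *)
Lemma computable_sort_formulas : computable_formulas sort_formulas.
Proof.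
  apply computable_set_iff.
  (* The pair at y is (codes of xs, (codes of ys, body)); [pred] undoes the
     successor in the code of a nonempty list. *)
  pose (code e := pformula_code (sort_formula e)).
  apply (decidable_ext (fun _ n => n = code (pi1 (pi1 (pred (pi1 (pi2 n))))))).
  - intros i n. split.
    + intros ->. eexists. split; [eexists|]; reflexivity.
    + intros (p & [e ->] & ->).
      assert (E : pi1 (pi1 (pred (pi1 (pi2 (code e))))) = e).
      { unfold code, pformula_code. rewrite pi2_pair, pi1_pair.
        unfold vars_code, var_code. cbn. now rewrite !pi1_pair. }
      symmetry. exact (f_equal code E).
  - apply decidable_eq; [auto with comp|].
    unfold code, pformula_code, vars_code. cbn. unfold var_code. cbn [fst snd].
    auto 20 using computable_pred with comp.
Qed.

Lemma holds_sort_formula N e a d :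
  holds N (sort_formula e) a d <-> a = [] /\ exists x, d = [x] /\ sort N e x.
Proof.
  unfold holds, tuple_of. cbn. split.
  - intros (Ha & Hd & _). split; [now inversion Ha|].
    inversion Hd as [|? x ? l Hx Hl]; subst. inversion Hl. eauto.
  - intros (-> & x & -> & Hx). repeat split; auto.
    exists (fun _ => x). auto.
Qed.

Lemma finite_sort_formula N e : finite (holds N (sort_formula e) []) <-> finite (sort N e).
Proof.
  split; intros [l Hl].
  - exists (concat l). intros x Hx. apply in_concat. exists [x].
    split; [|now left]. apply Hl, holds_sort_formula. eauto.
  - exists (map (fun x => [x]) l). intros d Hd.
    apply holds_sort_formula in Hd as (_ & x & -> & Hx).
    apply in_map_iff. eauto.
Qed.

(** The formulas have no parameters, so what a step adds is independent of the
    set reached before it; a single step suffices. *)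
Lemma acl_sort_formulas N B b :
  acl sort_formulas N B b <-> B b \/ exists e, sort N e b /\ finite (sort N e).
Proof.
  split.
  - intros [m Hm]. revert b Hm. induction m as [|m IH]; cbn; [auto|].
    intros b [Hb|(p & a & [e ->] & _ & Hfin & bs & Hbs & Hin)]; [now apply IH|].
    right. exists e. apply holds_sort_formula in Hbs as (-> & x & -> & Hx).
    destruct Hin as [<-|[]]. split; [exact Hx|]. now apply finite_sort_formula.
  - intros [Hb|(e & Hb & Hfin)]; [now exists 0|].
    exists 1. right. exists (sort_formula e), [].
    split; [now exists e|]. split; [constructor|].
    split; [now apply finite_sort_formula|].
    exists [b]. split; [|now left]. apply holds_sort_formula. eauto.
Qed.

(** [a] is in the closure of [u] when it is in [u], or has some sort [j] whose
    elements are all at most some [b].  The witness is the pair of [b] and [j];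
    that [u] is a set of elements of [N] can be checked one [z] at a time, so it
    joins the universal part. *)
Lemma Sigma02_acl L N :
  computable_structure L N -> Sigma02 (acl_set sort_formulas N).
Proof.
  intros (s & _ & d & p & q & _ & Hd & Hp & _).
  assert (Hdom : decidable_in (I := unit) no_oracle (fun _ => dom N))
    by (apply computable_set_iff; now exists d).
  assert (Hsort : decidable_in (I := unit) no_oracle (fun _ => sort_set N))
    by (apply computable_set_iff; now exists p).
  pose (R a u b j z :=
    (canonical u z -> dom N z) /\
    (canonical u a \/
      sort_set N (pair a j) /\ (sort_set N (pair z j) -> z <= b))).
  exists (fun w => R (pi1 (pi1 w)) (pi2 (pi1 w))
                     (pi1 (pi1 (pi2 w))) (pi2 (pi1 (pi2 w))) (pi2 (pi2 w))).
  split.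
  - apply computable_set_iff.
    apply decidable_and; [apply decidable_imp|apply decidable_or;
      [|apply decidable_and; [|apply decidable_imp]]].
    + apply decidable_testbit; auto with comp.
    + apply (decidable_comp (fun _ => dom N)); auto with comp.
    + apply decidable_testbit; auto with comp.
    + apply (decidable_comp (fun _ => sort_set N)); auto with comp.
    + apply (decidable_comp (fun _ => sort_set N)); auto with comp.
    + apply decidable_le; auto with comp.
  - intros x. split.
    + intros (a & u & -> & Hu & Ha). apply acl_sort_formulas in Ha.
      destruct Ha as [Ha|(j & Ha & Hfin)].
      * exists 0. intros z. split; rewrite !pi1_pair, !pi2_pair; auto.
      * apply finite_nat_iff in Hfin as [b Hb]. exists (pair b j). intros z.
        split; rewrite ?pi1_pair, ?pi2_pair, ?pi1_pair, ?pi2_pair; auto.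
        right. rewrite !sort_set_pair. auto.
    + intros [y Hy]. exists (pi1 x), (pi2 x). split; [symmetry; apply pair_pi|].
      assert (Hy' : forall z, R (pi1 x) (pi2 x) (pi1 y) (pi2 y) z).
      { intros z. specialize (Hy z). now rewrite !pi2_pair, !pi1_pair in Hy. }
      split; [intros z; apply (Hy' z)|]. apply acl_sort_formulas.
      destruct (classic (canonical (pi2 x) (pi1 x))) as [Hin|Hout]; [now left|right].
      exists (pi2 y). split.
      * destruct (Hy' 0) as [_ [H|[H _]]]; [contradiction|now apply sort_set_pair].
      * apply finite_nat_iff. exists (pi1 y). intros z Hz.
        destruct (Hy' z) as [_ [H|[_ H]]]; [contradiction|]. now apply H, sort_set_pair.
Qed.

(** * Finiteness of sorts and membership in Fin *)

(** The image is taken along a functional relation, not a function, so that it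
    can be used where only some [x] have a value and finding it needs a search,
    as for the index [i] with [enum i = (e, n)]. *)
Lemma finite_image {S T : Type} (P : S -> Prop) (Q : T -> Prop) (R : S -> T -> Prop) :
  (forall x y y', R x y -> R x y' -> y = y') ->
  (forall y, Q y -> exists x, P x /\ R x y) -> finite P -> finite Q.
Proof.
  intros HR HQ [l Hl].
  assert (H : exists l', forall x y, In x l -> R x y -> In y l').
  { clear Hl. induction l as [|x l [l' IH]]; [now exists []|].
    destruct (classic (exists y, R x y)) as [[y Hy]|Hno].
    - exists (y :: l'). intros x' y' [<-|Hin] Hy'; [left; eauto|right; eauto].
    - exists l'. intros x' y' [<-|Hin] Hy'; [elim Hno; eauto|eauto]. }
  destruct H as [l' Hl']. exists l'. intros y Hy.
  destruct (HQ y Hy) as (x & Hx & Hxy). eauto.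
Qed.

Lemma finite_union {T : Type} (P Q : T -> Prop) :
  finite P -> finite Q -> finite (fun x => P x \/ Q x).
Proof.
  intros [l Hl] [l' Hl']. exists (l ++ l'). intros x [H|H]; apply in_app_iff; auto.
Qed.

Lemma sort_unique L N j j' a :
  is_structure L N -> sort N j a -> sort N j' a -> j = j'.
Proof.
  intros (Hsd & Hex & _) Hj Hj'. destruct (Hex a) as (k & _ & Hk); [now apply (Hsd j)|].
  now rewrite <- (Hk j Hj), <- (Hk j' Hj').
Qed.

Lemma finite_sort_isomorphic L N M e :
  is_structure L N -> is_structure L M -> isomorphic N M ->
  finite (sort N e) <-> finite (sort M e).
Proof.
  intros (HN & _) (HM & _) (f & Hdom & Hinj & Hsurj & Hsort & _).
  split.
  - apply (finite_image _ _ (fun a b => f a = b)); [congruence|].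
    intros b Hb. destruct (Hsurj b) as (a & Ha & <-); [now apply (HM e)|].
    exists a. split; [now apply Hsort|reflexivity].
  - apply (finite_image _ _ (fun b a => dom N a /\ f a = b)).
    + intros b a a' [Ha <-] [Ha' E]. now apply Hinj.
    + intros a Ha. exists (f a). assert (dom N a) by now apply (HN e).
      split; [now apply Hsort|auto].
Qed.

(** The correspondence between the elements [Num i] of sort [X_e] and the inputs
    on which [{e}] converges is the enumeration; as it has no repetitions it is
    a bijection, and adding two points preserves finiteness. *)
Lemma finite_sort_iff_Fin L M (enum : nat -> nat * nat) e :
  (forall i k, enum i = enum k -> i = k) ->
  (forall e n, converges e n <-> exists i, enum i = (e, n)) ->
  is_structure L M ->
  (forall m, dom M m <-> exists x : elt, m = elt_code x) ->
  (forall b i, sort M i (elt_code (Pt b i))) ->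
  (forall i, sort M (fst (enum i)) (elt_code (Num i))) ->
  finite (sort M e) <-> Fin e.
Proof.
  intros Hinj Hrange HM Hdom Hpt Hnum. split.
  - apply (finite_image _ _ (fun m n => exists i, m = elt_code (Num i) /\ enum i = (e, n))).
    + intros m n n' (i & -> & Hi) (i' & E & Hi').
      assert (i = i') as <- by (cbn in E; lia). congruence.
    + intros n Hn. apply Hrange in Hn as [i Hi]. exists (elt_code (Num i)).
      split; [|eauto]. specialize (Hnum i). now rewrite Hi in Hnum.
  - intros Hfin.
    assert (Hu := fun j j' a => sort_unique L M j j' a HM).
    apply (finite_image (fun m => (exists n, converges e n /\
             exists i, enum i = (e, n) /\ m = elt_code (Num i)) \/
             (m = elt_code (Pt false e) \/ m = elt_code (Pt true e)))
             _ eq); [congruence| |].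
    + intros m Hm. exists m. split; [|reflexivity].
      destruct (proj1 (Hdom m)) as [[i|b i] ->]; [now apply (proj1 HM e)| |].
      * left. destruct (enum i) as [e' n] eqn:Hi. exists n.
        specialize (Hnum i). rewrite Hi in Hnum.
        rewrite (Hu _ _ _ Hm Hnum) in *. split; [apply Hrange|]; eauto.
      * right. rewrite (Hu _ _ _ Hm (Hpt b i)). destruct b; auto.
    + apply finite_union.
      * revert Hfin.
        apply (finite_image _ _
          (fun n m => exists i, enum i = (e, n) /\ m = elt_code (Num i))).
        -- intros n m m' (i & Hi & ->) (i' & Hi' & ->).
           now rewrite (Hinj i i') by congruence.
        -- auto.
      * exists [elt_code (Pt false e); elt_code (Pt true e)].
        intros m [-> | ->]; cbn; auto.
Qed.

(** * The reduction *)

(** The index 0 is that of the empty set. *)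
Lemma one_reduction_acl L N a :
  is_structure L N -> (forall e, sort N e (a e)) ->
  (forall e, finite (sort N e) <-> Fin e) ->
  one_reduction (fun e => pair (a e) 0) Fin (acl_set sort_formulas N).
Proof.
  intros HN Ha Hfin. split.
  - intros e e' H. apply pair_inj in H as [H _].
    apply (sort_unique L N _ _ (a e) HN); [apply Ha|rewrite H; apply Ha].
  - intros e. rewrite <- Hfin.
    assert (H0 : forall x, ~ canonical 0 x)
      by (intros x; unfold canonical; now rewrite Nat.bits_0).
    split.
    + intros He. exists (a e), 0. split; [reflexivity|].
      split; [intros x Hx; now elim (H0 x)|].
      apply acl_sort_formulas. right. now exists e.
    + intros (b & u & H & _ & Hb). apply pair_inj in H as [<- <-].
      apply acl_sort_formulas in Hb as [Hb|(e' & Hb & He)]; [now elim (H0 (a e))|].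
      now rewrite (sort_unique L N _ _ _ HN (Ha e) Hb).
Qed.

Lemma one_reduction_trans f g A B C :
  one_reduction f A B -> one_reduction g B C -> one_reduction (fun n => g (f n)) A C.
Proof.
  intros [Hf HAB] [Hg HBC]. split; [auto|].
  intros n. now rewrite HAB, HBC.
Qed.

Theorem proposition4p3
  (enum : nat -> nat * nat)
  (enum_computable : computable_fun (fun i => Cantor.to_nat (enum i)))
  (enum_injective : forall i k, enum i = enum k -> i = k)
  (enum_range : forall e n, converges e n <-> exists i, enum i = (e, n))
  (c : nat) (L : language) (M : structure)
  (c_code : CompStr_code c L M)
  (* the symbols U_i and V_i are the relation symbols of L with indices
     U i and V i, each relation symbol being listed exactly once *)
  (U V : nat -> nat)
  (L_sorts : sorts L = AllNat)
  (L_rels : rels L = AllNat)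
  (U_injective : forall i k, U i = U k -> i = k)
  (V_injective : forall i k, V i = V k -> i = k)
  (UV_disjoint : forall i k, U i <> V k)
  (UV_all : forall r, exists i, r = U i \/ r = V i)
  (U_type : forall i, rel_type L (U i) = [i])
  (V_type : forall i, rel_type L (V i) = [i])
  (M_dom : forall m, dom M m <-> exists x : elt, m = elt_code x)
  (M_U : forall i b, rel M (U i) b <-> b = [elt_code (Pt false i)])
  (M_V : forall i b, rel M (V i) b <-> b = [elt_code (Pt true i)])
  (M_sort : forall i, sort M (fst (enum i)) (elt_code (Num i))) :
  exists Xi : pformula -> Prop,
    (forall p, Xi p -> is_pformula L p /\ quantifier_free (body p)) /\
    computable_formulas Xi /\
    (exists p : program,
       forall N : structure, is_structure L N -> isomorphic N M ->
         exists f : nat -> nat,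
           computes (diagram N) p f /\ one_reduction f Fin (acl_set Xi N)) /\
    (forall N : structure, is_structure L N -> isomorphic N M ->
       computable_structure L N -> Sigma02_complete (acl_set Xi N)).
Proof.
  destruct c_code as (l & s & _ & _ & (_ & t & _ & Htype) & (HM & _)).
  assert (Hcode : computable_fun (fun r => list_code (rel_type L r))).
  { exists t. intros r. apply Htype. now rewrite L_rels. }
  assert (M_named : forall r, exists i b, rel_type L r = [i] /\
            rel M r [elt_code (Pt b i)]).
  { intros r. destruct (UV_all r) as [i [Hr|Hr]]; subst r; exists i;
      [exists false|exists true]; split; trivial; [now apply M_U|now apply M_V]. }
  assert (M_pt : forall b i, sort M i (elt_code (Pt b i))).
  { assert (H : forall r i m, rel_type L r = [i] -> rel M r [m] -> sort M i m).
    { intros r i m Hr H. apply HM in H as [_ H]. rewrite Hr in H. now inversion H. }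
    intros [|] i; [apply (H (V i))|apply (H (U i))]; trivial;
      [now apply M_V|now apply M_U]. }
  pose (model := {N : structure | is_structure L N /\ isomorphic N M}).
  pose (diag := fun N : model => diagram (proj1_sig N)).
  assert (N_named : forall (N : model) r, exists a, rel (proj1_sig N) r [a]).
  { intros N r. destruct (proj2_sig N) as [_ (f & _ & _ & Hsurj & _ & Hrel)].
    destruct (M_named r) as (i & b & _ & Hb).
    destruct (Hsurj (elt_code (Pt b i))) as (a & Ha & Hfa).
    - apply M_dom. eauto.
    - exists a. apply Hrel; [auto|]. cbn. now rewrite Hfa. }
  (* U and V come without an algorithm, so a symbol naming a point of sort e is
     found by its type; it may turn out to be either U e or V e. *)
  assert (Hw : exists w, computable_in diag w /\ forall N e, rel_type L (w N e) = [e]).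
  { destruct (computable_search (O := diag)
      (fun _ m => list_code (rel_type L (pi2 m)) = list_code [pi1 m]))
      as (w & Hw & HwL).
    - apply decidable_eq; [|cbn; auto with comp].
      apply (computable_comp (fun _ r => list_code (rel_type L r))); [|auto with comp].
      now apply (computable_fun_in diag).
    - intros N e. exists (U e). now rewrite pi1_pair, pi2_pair, U_type.
    - exists w. split; [exact Hw|]. intros N e. specialize (HwL N e). cbn beta in HwL.
      rewrite pi1_pair, pi2_pair in HwL. now apply list_code_inj. }
  destruct Hw as (w & Hw & HwL).
  destruct (computable_search (O := diag)
    (fun N m => diag N (pair 2 (pair (list_code [pi2 m]) (w N (pi1 m))))))
    as (a & Ha & HaN).
  { apply decidable_comp; [apply decidable_oracle|].
    assert (computable_in diag (fun N m => w N (pi1 m)))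
      by (apply computable_comp; auto with comp).
    cbn. auto 10 with comp. }
  { intros N e. destruct (N_named N (w N e)) as [a Ha]. exists a.
    rewrite pi1_pair, pi2_pair. now apply diagram_rel. }
  assert (Hred : forall N : model,
    one_reduction (fun e => pair (a N e) 0) Fin (acl_set sort_formulas (proj1_sig N))).
  { intros N. destruct (proj2_sig N) as [HN Hiso].
    apply (one_reduction_acl L _ _ HN).
    - intros e. specialize (HaN N e). cbn beta in HaN.
      rewrite pi1_pair, pi2_pair in HaN.
      apply diagram_rel, HN in HaN as [_ HaN]. rewrite HwL in HaN. now inversion HaN.
    - intros e. rewrite (finite_sort_isomorphic L _ M e HN HM Hiso).
      now apply (finite_sort_iff_Fin L M enum). }
  assert (Hcomp : computable_in diag (fun N e => pair (a N e) 0)) by auto with comp.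
  destruct Hcomp as [p Hp].
  exists sort_formulas. split; [|split; [apply computable_sort_formulas|split]].
  - intros q [e ->]. split; [|exact I]. split; [|split].
    + cbn. now rewrite L_sorts.
    + constructor; [intros []|constructor].
    + intros x. cbn. intuition congruence.
  - exists p. intros N HN Hiso. pose (m := exist _ N (conj HN Hiso) : model).
    exists (fun e => pair (a m e) 0). split; [apply (Hp m)|apply (Hred m)].
  - intros N HN Hiso HNc. pose (m := exist _ N (conj HN Hiso) : model).
    split; [now apply (Sigma02_acl L)|]. intros B HB.
    destruct (Fin_hard B HB) as (g & Hg & HBg).
    exists (fun n => pair (a m (g n)) 0). split.
    + apply computable_fun_iff.
      apply (computable_comp (fun _ e => pair (a m e) 0) (fun _ => g));
        [|now apply computable_fun_iff].
      apply (computable_change_oracle (fun _ => diagram N)).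
      * now apply computable_set_iff, (computable_diagram L).
      * exists p. intros i. apply (Hp m).
    + exact (one_reduction_trans g _ _ _ _ HBg (Hred m)).
Qed.
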